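(* Let $(X,\|\cdot\|)$ be a Banach space, $T:X\to X$ a nonexpansive map, $f:[0,\infty)\to X$ a continuous function, $x_0\in X$, and let $u:[0,\infty)\to X$ be the unique solution of $$u'(t)+(I-T)u(t)=f(t),\qquad u(0)=x_0.$$ Let $\epsilon:[0,\infty)\to[0,\infty)$ be a continuous function with $\epsilon(t)\ge\|f(t)\|$ for all $t\ge0$. Assume that $\mathrm{Fix}(T)\ne\emptyset$, that $\epsilon(\cdot)$ is decreasing (i.e. nonincreasing) with $S=\int_0^\infty\epsilon(t)\,dt<\infty$, and let $\kappa=2\,\mathrm{dist}(x_0,\mathrm{Fix}(T))+S$ and $\nu=(\kappa+2\sqrt2\,S)/\sqrt\pi$. Then, for all $t\ge1$, $$\|u'(t)\|\le\frac{\nu}{\sqrt t}+\int_{t/2}^\infty4\,\epsilon(s)\,ds.$$ Moreover, if $\varphi:[0,\infty)\to[0,\infty)$ is nondecreasing and $\mu=\int_0^\infty\varphi(s)\epsilon(s)\,ds<\infty$, then $$\|u'(t)\|\le\frac{\nu}{\sqrt t}+\frac{4\mu}{\varphi(t/2)}$$ for all $t\ge1$ with $\varphi(t/2)>0$. In particular, if $\int_0^\infty s^a\,\epsilon(s)\,ds<\infty$ for some $a\ge0$, then $\|u'(t)\|=O(1/t^b)$ as $t\to\infty$, with $b=\min\{\frac12,a\}$.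
   Context: $T$ nonexpansive means $\|Tx-Ty\|\le\|x-y\|$ for all $x,y\in X$; $\mathrm{Fix}(T)=\{x\in X:Tx=x\}$; $I$ is the identity map. *)

(* Defs.v *)
From HB Require Import structures.
From mathcomp Require Import all_boot all_order all_algebra.
From mathcomp Require Import all_classical all_reals all_analysis.

Set Implicit Arguments.
Unset Strict Implicit.
Unset Printing Implicit Defensive.

Import Order.TTheory GRing.Theory Num.Theory.
Import numFieldNormedType.Exports.

Local Open Scope classical_set_scope.
Local Open Scope ring_scope.

Definition nonexpansive (R : realType) (X : completeNormedModType R)
    (T : X -> X) : Prop :=
  forall x y : X, `|T x - T y| <= `|x - y|.

Definition Fix (X : Type) (T : X -> X) : set X := [set x | T x = x].

(* Only meaningful for nonempty [A]: [inf set0 = 0]. *)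
Definition dist (R : realType) (X : completeNormedModType R)
    (x : X) (A : set X) : R :=
  inf [set `|x - y| | y in A].

(* Functions on [0, +oo[ are represented by functions on [R] whose values at
   negative arguments are irrelevant. Hence the equation at [t = 0] involves
   the right derivative, whereas for [t > 0] it involves the usual one.
   Continuity of [u] on [0, +oo[ follows from differentiability. *)
Definition is_solution (R : realType) (X : completeNormedModType R)
    (T : X -> X) (f : R -> X) (x0 : X) (u : R -> X) : Prop :=
  [/\ u 0 = x0,
      exists2 du0 : X, h^-1 *: (u h - u 0) @[h --> 0^'+] --> du0
                     & du0 + (u 0 - T (u 0)) = f 0
    & forall t : R, 0 < t ->
        derivable u t 1 /\ derive1 u t + (u t - T (u t)) = f t].

(* Main.v *)
Require Import Defs.
From mathcomp Require Import all_boot all_order all_algebra.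
From mathcomp Require Import all_classical all_reals all_analysis.
From mathcomp Require Import measurable_realfun.
From mathcomp Require Import ring lra.

Set Implicit Arguments.
Unset Strict Implicit.
Unset Printing Implicit Defensive.

Import Order.TTheory GRing.Theory Num.Theory.
Import numFieldNormedType.Exports.

Local Open Scope classical_set_scope.
Local Open Scope ring_scope.

(** The estimate is a comparison principle in two time variables. For
    [0 <= s <= t] put [d(s,t) = |u t - u s|] and [e(s,t) = |u s - T (u t)|].
    Since [u' = T u - u + f] and [T] is nonexpansive, upper right derivatives
    satisfy the closed system
      [d_t <= e - d + eps t],   [e_s <= d - e + eps s],
    with [d(s,s) = 0] and [e(0,t)] controlled by the distance from [x0] to a
    fixed point. The system is cooperative, so [e] lies below every
    supersolution ([comparison]); the contraction factor [1 - exp(-(L - a))]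
    gained at each pass around the system makes this work without any
    compactness.

    For [eps = 0] and [e(0,t) = 1], writing [e = exp(-(s+t)) E] and
    [d = exp(-(s+t)) D] turns the system into [E_s = D], [D_t = E],
    [E(0,t) = exp t], [D(s,s) = 0]. Its solution is the series
    [E(s,t) = sum_m (exp t - P_m(t) - P_(m-1)(t)) s^m/m!], where [P_m] is the
    sum of the first [m] terms of the exponential series. Truncating the sum
    over [m] at a large [M] gives a supersolution that is a finite
    expression: the truncation error in [D_t = E] and the value
    [D(s,s) = P_M(s) (exp s - P_M(s))] both have the favourable sign. On the
    diagonal it equals, up to a vanishing remainder, a partial sum of
    [I_0(2t) + I_1(2t)] (modified Bessel functions), and
    [exp(-2t) (I_0(2t) + I_1(2t)) <= 1 / sqrt(pi t)] ([bessel_sum_le]): the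
    coefficients are Wallis integrals of powers of the cosine, and
    [1 + cos x <= 2 cos(x/2)] on [[0,pi]] reduces the resulting integral of
    [exp(2t cos x) (1 + cos x)] to a Gaussian one.

    The forcing is treated by using the comparison twice, first on [[0,t]]
    and then on [[t/2,t]]: twice the mass of [eps] on [[0,t/2]] enters as an
    initial value at time [t/2], hence with the factor [1 / sqrt(pi t/2)],
    while twice the mass on [[t/2,t]] is counted in full ([residual_bound]).
    Monotonicity of [eps] bounds the last term [eps t] of [|u' t| <= e(t,t) + eps t] by
    [2 * int_(t/2)^t eps]. The weighted bound follows because a nondecreasing
    weight [phi] satisfies
    [phi h * int_h^oo eps <= int_0^oo phi * eps]. *)

(** * Dini derivatives *)

(** A function whose upper right Dini derivative is nonpositive does not
    increase. Only left continuity is needed: from the right, the Dini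
    condition itself prevents upward jumps. *)
Lemma dini_le (R : realType) (g : R -> R) (a b : R) :
  a <= b ->
  (forall x, a < x <= b -> g y @[y --> x^'-] --> g x) ->
  (forall x, a <= x < b -> forall eta, 0 < eta ->
     \forall y \near x^'+, g y <= g x + eta * (y - x)) ->
  g b <= g a.
Proof.
move=> ab gl gd; apply/ler_addgt0Pr => e0 e0pos.
have [eta etapos etae] : exists2 eta : R, 0 < eta & eta * (b - a) <= e0.
  exists (e0 / (b - a + 1)).
    by rewrite divr_gt0// ltr_wpDl// subr_ge0.
  rewrite mulrAC ler_pdivrMr; last by rewrite ltr_wpDl// subr_ge0.
  by rewrite ler_pM2l// lerDl.
suff : g b <= g a + eta * (b - a) by move=> /le_trans; apply; rewrite lerD2l.
pose h x := g x - g a - eta * (x - a).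
pose A := [set x | a <= x <= b /\ h x <= 0].
have Aa : A a by split; rewrite ?lexx// /h !subrr mulr0 subr0.
have supA : has_sup A by split; [exists a|exists b => x [/andP[]]].
set c := sup A.
have ac : a <= c by exact: sup_upper_bound.
have cb : c <= b by apply: ge_sup => //; [exists a|move=> x [/andP[]]].
have hc : h c <= 0.
  rewrite leNgt; apply/negP => hc.
  have {}ac : a < c.
    rewrite lt_neqAle ac andbT; apply/eqP => ac'; move: hc; rewrite -ac'.
    by rewrite /h !subrr mulr0 subr0 ltxx.
  have hcv : h y @[y --> c^'-] --> h c.
    rewrite /h; apply: cvgB.
      by apply: cvgB; [apply: gl; rewrite ac|exact: cvg_cst].
    apply: cvgM; [exact: cvg_cst|apply: cvgB; last exact: cvg_cst].
    exact: cvg_at_left_filter.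
  have := cvgr_gt _ hcv _ hc.
  rewrite near_withinE => hnear.
  have [r /= r0 hr] := (nbhs_ballP _ _).1 (hnear _).
  have [y Ay yc] := sup_adherent r0 supA.
  have yc' : y <= c by exact: sup_upper_bound.
  have hy := Ay.2.
  have /eqP ync : y != c by apply/eqP => yc1; move: hy; rewrite yc1 leNgt hc.
  have : 0 < h y.
    apply: (hr y); last by rewrite lt_neqAle yc' andbT; apply/eqP.
    by rewrite /ball/= ger0_norm ?subr_ge0// ltrBlDr addrC -ltrBlDr.
  by rewrite ltNge hy.
have [{}cb|bc|cb'] := ltgtP c b; last first.
- by move: hc; rewrite cb' /h subr_le0 lerBlDl.
- by move: bc; rewrite ltNge cb.
have := gd c; rewrite ac cb => /(_ erefl _ etapos) gdc.
near c^'+ => y.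
have cy : c < y by near: y; exact: nbhs_right_gt.
have yb : y <= b by near: y; exact: nbhs_right_le.
have gy : g y <= g c + eta * (y - c) by near: y; exact: gdc.
suff : A y by move/(sup_upper_bound supA); rewrite leNgt cy.
split; first by rewrite (le_trans ac (ltW cy)).
by move: hc gy; rewrite /h; lra.
Unshelve. all: by end_near. Qed.

(** Comparison with [m * (1 - expR (- (x - a)))], the solution of
    [g' = m - g], [g a = 0]. *)
Lemma dini_decay (R : realType) (g : R -> R) (a b m : R) :
  a <= b ->
  (forall x, a < x <= b -> g y @[y --> x^'-] --> g x) ->
  (forall x, a <= x < b -> forall eta, 0 < eta ->
     \forall y \near x^'+, g y <= g x + (m - g x + eta) * (y - x)) ->
  g a <= 0 ->
  g b <= m * (1 - expR (- (b - a))).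
Proof.
move=> ab gl gd ga.
(* The integrating factor turns the hypothesis into a nonpositive Dini
   derivative of [G]. *)
pose G x := expR x * (g x - m).
have : G b <= G a.
  apply: dini_le => // x.
    move=> axb; rewrite /G; apply: cvgM.
      by apply: cvg_at_left_filter; exact: continuous_expR.
    by apply: cvgB; [exact: gl|exact: cvg_cst].
  move=> axb eta eta0.
  set K := expR (x + 1).
  have K0 : 0 < K by exact: expR_gt0.
  have e20 : 0 < eta / 2 / K by rewrite divr_gt0// divr_gt0.
  near=> y.
  have xy : x < y by near: y; exact: nbhs_right_gt.
  have y1 : y < x + 1 by near: y; apply: nbhs_right_lt; rewrite ltrDl.
  have gy : g y <= g x + (m - g x + eta / 2 / K) * (y - x).
    by near: y; exact: gd.
  have small : K * `|g x - m| * (y - x) <= eta / 2.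
    have : y < x + eta / 2 / (K * `|g x - m| + 1).
      near: y; apply: nbhs_right_lt; rewrite ltrDl divr_gt0 ?divr_gt0//.
      by rewrite ltr_wpDl// mulr_ge0// ltW.
    rewrite -ltrBlDl ltr_pdivlMr; last by rewrite ltr_wpDl// mulr_ge0// ltW.
    move=> /ltW; apply: le_trans; rewrite mulrC ler_wpM2l//;
      first by rewrite subr_ge0 ltW.
    by rewrite lerDl.
  rewrite /G.
  have eyK : expR y <= K by rewrite ler_expR ltW.
  have ex0 := expR_gt0 x; have ey0 := expR_gt0 y.
  have l1 : expR y * (1 - (y - x)) <= expR x.
    have := expR_ge1Dx (x - y); rewrite (_ : 1 + (x - y) = 1 - (y - x)); last by lra.
    move=> /(ler_wpM2l (ltW ey0)) /le_trans; apply.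
    by rewrite -expRD addrC subrK.
  have l2 : expR x - K * (y - x) * (y - x) <= expR y * (1 - (y - x)).
    have h1 : expR x * (1 + (y - x)) <= expR y.
      have := expR_ge1Dx (y - x) => /(ler_wpM2l (ltW ex0)) /le_trans; apply.
      by rewrite -expRD addrC subrK.
    have h2 : expR x <= K by rewrite ler_expR lerDl.
    have h3 : 0 <= 1 - (y - x) by lra.
    have h4 := ler_wpM2r h3 h1.
    have h5 : expR x * (y - x)^+2 <= K * (y-x)^+2 by rewrite ler_wpM2r// sqr_ge0.
    move: h4 h5; rewrite !expr2; nra.
  have l3 : expR y * (g y - m) <=
     (g x - m) * (expR y * (1 - (y - x))) + expR y * (eta / 2 / K) * (y - x).
    have := ler_wpM2l (ltW ey0) gy; nra.
  have l4 : expR y * (eta / 2 / K) <= eta / 2.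
    rewrite mulrA ler_pdivrMr// mulrC ler_wpM2l// ltW// divr_gt0//.
  have l5 : (g x - m) * (expR y * (1 - (y - x))) - expR x * (g x - m) <=
      K * `|g x - m| * (y - x) * (y - x).
    rewrite (mulrC (expR x)) -mulrBr.
    apply: (le_trans (ler_norm _)); rewrite normrM.
    rewrite (mulrC K) -!mulrA; apply: ler_wpM2l => //.
    by rewrite ler_norml; apply/andP; split; move: l1 l2; nra.
  have yx0 : 0 <= y - x by rewrite subr_ge0 ltW.
  have l6 := ler_wpM2r yx0 small.
  have l7 : expR y * (eta / 2 / K) * (y - x) <= eta / 2 * (y - x).
    by rewrite ler_wpM2r// subr_ge0 ltW.
  move: l3 l5 l6 l7; lra.
rewrite /G => Gba.
have : g b - m <= - m * expR (- (b - a)).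
  rewrite -(ler_pM2l (expR_gt0 b)) (le_trans Gba)//.
  rewrite mulrCA -expRD (_ : b + - (b - a) = a); last by lra.
  by rewrite mulrC ler_pM2r ?expR_gt0// lerBlDr addNr.
lra.
Unshelve. all: by end_near. Qed.

(** * Derivatives *)

(** First order expansion from a right derivative. *)
Lemma right_diff_expansion (R : realType) (V : normedModType R) (F : R -> V)
    (x : R) (v : V) :
  h^-1 *: (F (x + h) - F x) @[h --> 0^'+] --> v ->
  forall eta, 0 < eta ->
    \forall y \near x^'+, `|F y - F x - (y - x) *: v| <= eta * (y - x).
Proof.
move=> Fv eta eta0.
move/cvgr_dist_le : Fv => /(_ _ eta0).
rewrite near_withinE => hnear.
have [r /= r0 hr] := (nbhs_ballP _ _).1 hnear.
near=> y.
have xy : x < y by near: y; exact: nbhs_right_gt.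
have yr : y < x + r by near: y; apply: nbhs_right_lt; rewrite ltrDl.
have h0 : 0 < y - x by rewrite subr_gt0.
have := hr (y - x) _ h0; rewrite (addrC x) subrK => /(_ _).
move=> /(_ _) H.
have {H} : `|v - (y - x)^-1 *: (F y - F x)| <= eta.
  by apply: H; rewrite /ball/= sub0r normrN gtr0_norm//; lra.
rewrite distrC => H.
rewrite (_ : F y - F x - _ = (y - x) *: ((y - x)^-1 *: (F y - F x) - v)).
  by rewrite normrZ gtr0_norm// mulrC ler_pM2r.
by rewrite scalerBr scalerA divff ?gt_eqF// scale1r.
Unshelve. all: by end_near. Qed.

Lemma derive_right_diff (R : realType) (V : normedModType R) (F : R -> V)
    (x : R) (v : V) :
  is_derive x 1 F v -> h^-1 *: (F (x + h) - F x) @[h --> 0^'+] --> v.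
Proof.
move=> [dF <-]; apply: cvg_dnbhs_at_right.
have -> : (fun h => h^-1 *: (F (x + h) - F x)) =
    (fun h => h^-1 *: ((F \o shift x) (h *: 1) - F x)).
  by apply/funext => h /=; rewrite [h *: 1]mulr1 (addrC x).
exact: dF.
Qed.

Lemma derive_expansion (R : realType) (V : normedModType R) (F : R -> V)
    (x : R) (v : V) :
  is_derive x 1 F v -> forall eta, 0 < eta ->
    \forall y \near x^'+, `|F y - F x - (y - x) *: v| <= eta * (y - x).
Proof. by move=> /derive_right_diff; exact: right_diff_expansion. Qed.

Lemma derive_cvg_left (R : realType) (V : normedModType R) (F : R -> V)
    (x : R) (v : V) :
  is_derive x 1 F v -> F y @[y --> x^'-] --> F x.
Proof.
move=> [dF _]; apply: cvg_at_left_filter.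
exact: (differentiable_continuous ((derivable1_diffP _ _).1 dF)).
Qed.

Lemma derive_ge0_le (R : realType) (g dg : R -> R) (a b : R) :
  a <= b ->
  (forall x, a <= x <= b -> is_derive x 1 g (dg x)) ->
  (forall x, a <= x <= b -> 0 <= dg x) ->
  g a <= g b.
Proof.
move=> ab gd dg0.
have [x| |c cab H] := @MVT_segment R g dg a b ab.
- by rewrite in_itv/= => /andP[/ltW ax /ltW xb]; apply: gd; rewrite ax.
- apply: derivable_within_continuous => x; rewrite in_itv/= => axb.
  by have [] := gd x axb.
- rewrite -subr_ge0 H mulr_ge0 ?subr_ge0//.
  by apply: dg0; rewrite in_itv/= in cab.
Qed.

Lemma is_derive_bigsum (R : realType) n (h dh : nat -> R -> R) (x : R) :
  (forall i, is_derive x 1 (h i) (dh i x)) ->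
  is_derive x 1 (fun y => \sum_(i < n) h i y) (\sum_(i < n) dh i x).
Proof.
move=> H.
have -> : (fun y => \sum_(i < n) h i y) = \sum_(i < n) h i.
  by apply/funext => y; rewrite fct_sumE.
exact: (@is_derive_sum _ _ _ n (fun i => h i) x 1 (fun i => dh i x)).
Qed.

(** * Comparison in two time variables *)

Section two_time_comparison.
Context (R : realType) (X : completeNormedModType R).
Variables (T : X -> X) (f : R -> X) (x0 : X) (u : R -> X) (eps : R -> R).
Hypothesis T_nonexp : nonexpansive T.
Hypothesis u_sol : is_solution T f x0 u.
Hypothesis eps_f : forall t : R, 0 <= t -> `|f t| <= eps t.

(** At [t = 0] the equation only provides a right derivative, so the whole
    argument is run with right derivatives. *)
Lemma solution_right_diff (t : R) : 0 <= t ->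
  h^-1 *: (u (t + h) - u t) @[h --> 0^'+] --> f t - (u t - T (u t)).
Proof.
case: u_sol => u0 [du0 du0E du0f] ut.
rewrite le_eqVlt => /predU1P[<-|t0].
  rewrite -du0f addrK.
  by under eq_fun do rewrite add0r.
have [dut dutE] := ut _ t0.
rewrite -dutE addrK derive1E.
apply: derive_right_diff; exact: derivableP.
Qed.

Lemma solution_cvg_left (t : R) : 0 < t -> u y @[y --> t^'-] --> u t.
Proof.
case: u_sol => _ _ ut t0.
have [dut _] := ut _ t0.
by apply: derive_cvg_left; exact: derivableP.
Qed.

(** One explicit Euler step of length [y - t], seen from a given point [z]:
    [u y] is close to a convex combination of [u t] and [T (u t)], moved by
    [(y - t) * f t]. *)
Lemma solution_step (t eta : R) (z : X) : 0 <= t -> 0 < eta ->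
  \forall y \near t^'+, `|u y - z| <=
    `|u t - z| + (`|T (u t) - z| - `|u t - z| + eps t + eta) * (y - t).
Proof.
move=> t0 eta0.
have := right_diff_expansion (solution_right_diff t0) eta0.
move=> H; near=> y.
have ty : t < y by near: y; exact: nbhs_right_gt.
have yt : y < t + 1 by near: y; apply: nbhs_right_lt; rewrite ltrDl.
have h0 : 0 <= y - t by rewrite subr_ge0 ltW.
have h1 : 0 <= 1 - (y - t) by lra.
have : `|u y - u t - (y - t) *: (f t - (u t - T (u t)))| <= eta * (y - t).
  by near: y; exact: H.
set r := u y - u t - _ => rle.
have -> : u y - z = (1 - (y - t)) *: (u t - z) + (y - t) *: (T (u t) - z)
    + (y - t) *: f t + r.
  have hE : (y - t) *: (f t - (u t - T (u t))) =
      - ((y - t) *: (u t - z)) + (y - t) *: (T (u t) - z) + (y - t) *: f t.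
    rewrite -scalerN -!scalerDr opprB; congr (_ *: _).
    by rewrite [RHS]addrC; congr (_ + _); rewrite opprB [RHS]addrC addrA subrK.
  rewrite /r hE scalerBl scale1r -(addrA (u t - z)) -(addrA (u t - z)).
  by rewrite addrACA subrr addr0 addrC addrA subrK.
apply: (le_trans (ler_normD _ _)).
have n1 := ler_normD ((1 - (y - t)) *: (u t - z) + (y - t) *: (T (u t) - z))
   ((y - t) *: f t).
have n2 := ler_normD ((1 - (y - t)) *: (u t - z)) ((y - t) *: (T (u t) - z)).
move: n1 n2; rewrite !normrZ (ger0_norm h0) (ger0_norm h1) => n1 n2.
have n3 : (y - t) * `|f t| <= (y - t) * eps t by rewrite ler_wpM2l// eps_f.
move: n1 n2 n3 rle; lra.
Unshelve. all: by end_near. Qed.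

Lemma solution_dist_cvg_left (t : R) (z : X) : 0 < t ->
  `|u y - z| @[y --> t^'-] --> `|u t - z|.
Proof.
move=> t0; apply: cvg_norm; apply: cvgB; last exact: cvg_cst.
exact: solution_cvg_left.
Qed.

(** [N] plays the role of the primitive of [eps] vanishing at [0]. *)
Variable N : R -> R.
Hypothesis N0 : N 0 = 0.
Hypothesis eps_right : forall t : R, 0 <= t -> eps y @[y --> t^'+] --> eps t.
Hypothesis N_left : forall t : R, 0 < t -> N y @[y --> t^'-] --> N t.
Hypothesis N_ge : forall t y : R, 0 <= t <= y -> (y - t) * eps y <= N y - N t.

Lemma N_expansion (t eta : R) : 0 <= t -> 0 < eta ->
  \forall y \near t^'+, N t + (y - t) * (eps t - eta) <= N y.
Proof.
move=> t0 eta0.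
have H0 : \forall y \near t^'+, eps t - eta <= eps y.
  by apply: (cvgr_ge (eps t) (eps_right t0)); rewrite ltrBlDr ltrDl.
near=> y.
have ty : t <= y by near: y; exact: nbhs_right_ge.
have : eps t - eta <= eps y by near: y; exact: H0.
have := @N_ge t y; rewrite t0 ty => /(_ erefl) H.
move=> he; have := ler_wpM2l (_ : 0 <= y - t) he.
by rewrite subr_ge0 => /(_ ty) hm; move: H hm; lra.
Unshelve. all: by end_near. Qed.

Lemma solution_bound (p : X) (t : R) : Fix T p -> 0 <= t ->
  `|u t - p| <= `|x0 - p| + N t.
Proof.
move=> Tp t0.
suff : `|u t - p| - N t <= `|u 0 - p| - N 0.
  by rewrite N0 subr0 lerBlDr; case: u_sol => ->.
apply: (@dini_le _ (fun t => `|u t - p| - N t)) => // x.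
  move=> /andP[x0' _]; apply: cvgB; [exact: solution_dist_cvg_left|exact: N_left].
move=> /andP[x0' _] eta eta0.
have eta20 : 0 < eta / 2 by rewrite divr_gt0.
have H1 := @solution_step x _ p x0' eta20.
have H2 := @N_expansion x _ x0' eta20.
near=> y.
have xy : x <= y by near: y; exact: nbhs_right_ge.
have h1 : `|u y - p| <=
    `|u x - p| + (`|T (u x) - p| - `|u x - p| + eps x + eta / 2) * (y - x).
  by near: y; exact: H1.
have h2 : N x + (y - x) * (eps x - eta / 2) <= N y by near: y; exact: H2.
have h3 : `|T (u x) - p| <= `|u x - p| by rewrite -{1}Tp; exact: T_nonexp.
have h4 : (`|T (u x) - p| - `|u x - p|) * (y - x) <= 0.
  by apply: mulr_le0_ge0; rewrite ?subr_ge0// subr_le0.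
move: h1 h2 h4; lra.
Unshelve. all: by end_near. Qed.

(** From here on [(E, D)] is a supersolution, on the triangle
    [a <= s <= t <= L], of the system satisfied by [|u s - T (u t)|] and
    [|u t - u s|]. *)
Variables (a L : R).
Hypothesis a0 : 0 <= a.
Hypothesis aL : a <= L.
Variables (E D : R -> R -> R).
Hypothesis Dl : forall s t : R, a <= s -> s < t -> t <= L ->
  D s y @[y --> t^'-] --> D s t.
Hypothesis El : forall s t : R, a < s -> s <= t -> t <= L ->
  E y t @[y --> s^'-] --> E s t.
Hypothesis Dr : forall s t eta : R, a <= s -> s <= t -> t <= L -> 0 < eta ->
  \forall y \near t^'+,
    D s t + (y - t) * (E s t - D s t + eps t - eta) <= D s y.
Hypothesis Er : forall s t eta : R, a <= s -> s <= t -> t <= L -> 0 < eta ->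
  \forall y \near s^'+,
    E s t + (y - s) * (D s t - E s t + eps s - eta) <= E y t.
Hypothesis D0 : forall s : R, a <= s <= L -> 0 <= D s s.
Hypothesis E0 : forall t : R, a <= t <= L -> `|u a - T (u t)| <= E a t.

(** An excess [m] of [|u s - T (u t)|] over [E] gives an excess [m * q] of
    [|u t - u s|] over [D], with [q = 1 - exp(-(L - a)) < 1], which in turn
    gives an excess of at most [m * q] over [E]. *)
Lemma comparison_contract (m : R) :
  0 <= m ->
  (forall s t : R, a <= s -> s <= t -> t <= L -> `|u s - T (u t)| <= E s t + m) ->
  (forall s t : R, a <= s -> s <= t -> t <= L ->
     `|u s - T (u t)| <= E s t + m * (1 - expR (- (L - a)))).
Proof.
move: a0 aL => a_ge0 a_leL m0 Em.
set q := 1 - _.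
have qle (x y : R) : a <= x -> x <= y -> y <= L ->
    m * (1 - expR (- (y - x))) <= m * q.
  move=> ax xy yL; rewrite ler_wpM2l// lerD2l lerN2 ler_expR lerN2; lra.
have dD (s t : R) : a <= s -> s <= t -> t <= L -> `|u t - u s| <= D s t + m * q.
  move=> as_ st tL.
  suff : `|u t - u s| - D s t <= m * (1 - expR (- (t - s))).
    by rewrite lerBlDl => /le_trans; apply; rewrite lerD2l; exact: qle.
  apply: (@dini_decay _ (fun t : R => `|u t - u s| - D s t)) => //.
  - move=> x /andP[sx xt]; apply: cvgB.
      by apply: solution_dist_cvg_left; lra.
    by apply: Dl => //; lra.
  - move=> x /andP[sx xt] eta eta0.
    have x0' : 0 <= x by lra.
    have eta20 : 0 < eta / 2 by rewrite divr_gt0.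
    have H1 := @solution_step x _ (u s) x0' eta20.
    have xL : x <= L by lra.
    have H2 := @Dr s x _ as_ sx xL eta20.
    near=> y.
    have xy : x <= y by near: y; exact: nbhs_right_ge.
    have h1 : `|u y - u s| <= `|u x - u s| +
       (`|T (u x) - u s| - `|u x - u s| + eps x + eta / 2) * (y - x).
      by near: y; exact: H1.
    have h2 : D s x + (y - x) * (E s x - D s x + eps x - eta / 2) <= D s y.
      by near: y; exact: H2.
    have h3 : 0 <= (E s x + m - `|T (u x) - u s|) * (y - x).
      by rewrite mulr_ge0 ?subr_ge0// distrC; apply: Em.
    move: h1 h2 h3; lra.
  - by rewrite subrr normr0 sub0r oppr_le0; apply: D0; lra.
move=> s t as_ st tL.
suff : `|u s - T (u t)| - E s t <= (m * q) * (1 - expR (- (s - a))).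
  rewrite lerBlDl => /le_trans; apply; rewrite lerD2l.
  rewrite -[leRHS]mulr1; apply: ler_wpM2l; last by rewrite lerBlDr lerDl expR_ge0.
  by rewrite mulr_ge0// subr_ge0 expR_le1; lra.
apply: (@dini_decay _ (fun s : R => `|u s - T (u t)| - E s t)) => //.
- move=> x /andP[sx xt]; apply: cvgB.
    by apply: solution_dist_cvg_left; lra.
  by apply: El => //; lra.
- move=> x /andP[sx xt] eta eta0.
  have x0' : 0 <= x by lra.
  have eta20 : 0 < eta / 2 by rewrite divr_gt0.
  have H1 := @solution_step x _ (T (u t)) x0' eta20.
  have xt' : x <= t by lra.
  have H2 := @Er x t _ sx xt' tL eta20.
  near=> y.
  have xy : x <= y by near: y; exact: nbhs_right_ge.
  have h1 : `|u y - T (u t)| <= `|u x - T (u t)| +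
     (`|T (u x) - T (u t)| - `|u x - T (u t)| + eps x + eta / 2) * (y - x).
    by near: y; exact: H1.
  have h2 : E x t + (y - x) * (D x t - E x t + eps x - eta / 2) <= E y t.
    by near: y; exact: H2.
  have h3 : 0 <= (D x t + m * q - `|T (u x) - T (u t)|) * (y - x).
    rewrite mulr_ge0 ?subr_ge0// (le_trans (T_nonexp _ _))// distrC.
    exact: dD.
  move: h1 h2 h3; lra.
- by rewrite subr_le0; apply: E0; rewrite tL (le_trans as_ st).
Unshelve. all: by end_near. Qed.

(** The crude bound [M] is only used to start the iteration
    [M, M * q, M * q ^+ 2, ...]. *)
Lemma comparison (M : R) :
  (forall s t : R, a <= s -> s <= t -> t <= L -> `|u s - T (u t)| <= E s t + M) ->
  (forall s t : R, a <= s -> s <= t -> t <= L -> `|u s - T (u t)| <= E s t).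
Proof.
move: a0 aL => a_ge0 a_leL EM.
set q := 1 - expR (- (L - a)).
have q0 : 0 <= q by rewrite subr_ge0 expR_le1; lra.
have q1 : q < 1 by rewrite ltrBlDr ltrDl expR_gt0.
have Mn n (s t : R) : a <= s -> s <= t -> t <= L ->
    `|u s - T (u t)| <= E s t + `|M| * q ^+ n.
  elim: n s t => [|n IH] s t as_ st tL.
    rewrite expr0 mulr1 (le_trans (EM _ _ as_ st tL))// lerD2l; exact: ler_norm.
  rewrite exprSr mulrA; apply: comparison_contract => //.
  by rewrite mulr_ge0// exprn_ge0.
move=> s t as_ st tL.
have cv : (E s t + `|M| * q ^+ n) @[n --> \oo] --> E s t + `|M| * 0.
  apply: cvgD; first exact: cvg_cst.
  apply: cvgM; first exact: cvg_cst.
  by apply: cvg_expr; rewrite ger0_norm.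
rewrite mulr0 addr0 in cv.
rewrite -(cvg_lim _ cv)//; apply: limr_ge; first by apply/cvg_ex; eexists; exact: cv.
by near=> n; apply: Mn.
Unshelve. all: by end_near. Qed.

End two_time_comparison.

(** * A polynomial-exponential supersolution *)

Section supersolution.
Context (R : realType).
Implicit Types (s t L : R) (m n M : nat).

(** The general term of the exponential series. *)
Definition pow_fact n t : R := t ^+ n / n`!%:R.

(** The sum of the first [n] terms of the exponential series, up to the
    power [n.-1]. *)
Definition exp_poly n t : R := \sum_(i < n) pow_fact i t.

Lemma pow_fact_ge0 n t : 0 <= t -> 0 <= pow_fact n t.
Proof. by move=> t0; rewrite divr_ge0// exprn_ge0. Qed.

Lemma exp_polyS n t : exp_poly n.+1 t = exp_poly n t + pow_fact n t.
Proof. by rewrite /exp_poly big_ord_recr. Qed.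

Lemma exp_poly0 t : exp_poly 0 t = 0.
Proof. by rewrite /exp_poly big_ord0. Qed.

Lemma exp_poly_at0 n : exp_poly n.+1 0 = 1.
Proof.
elim: n => [|n IH]; rewrite exp_polyS.
  by rewrite exp_poly0 add0r /pow_fact expr0 fact0 divr1.
by rewrite IH /pow_fact expr0n/= mul0r addr0.
Qed.

Lemma exp_poly_ge0 n t : 0 <= t -> 0 <= exp_poly n t.
Proof. by move=> t0; apply: sumr_ge0 => i _; exact: pow_fact_ge0. Qed.

Lemma exp_poly_ge1 n t : 0 <= t -> 1 <= exp_poly n.+1 t.
Proof.
move=> t0; rewrite /exp_poly big_ord_recl /= {1}/pow_fact expr0 fact0 divr1.
by rewrite lerDl; apply: sumr_ge0 => i _; exact: pow_fact_ge0.
Qed.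

Lemma exp_poly_cvg t : exp_poly n t @[n --> \oo] --> expR t.
Proof.
have -> : exp_poly ^~ t = series (exp_coeff t).
  by apply/funext => n; rewrite /exp_poly /series/= big_mkord.
exact: is_cvg_series_exp_coeff.
Qed.

Lemma exp_poly_le n t : 0 <= t -> exp_poly n t <= expR t.
Proof.
move=> t0.
rewrite -(cvg_lim _ (@exp_poly_cvg t))//.
apply: (nondecreasing_cvgn_le (u_ := exp_poly ^~ t)); last first.
  by apply/cvg_ex; eexists; exact: exp_poly_cvg.
apply/nondecreasing_seqP => k; rewrite exp_polyS lerDl; exact: pow_fact_ge0.
Qed.

Lemma is_derive_pow_fact n t : is_derive t 1 (pow_fact n.+1) (pow_fact n t).
Proof.
have -> : pow_fact n.+1 = n.+1`!%:R^-1 *: (@id R ^+ n.+1).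
  by apply/funext => x; rewrite /pow_fact /= exprfctE mulrC.
have H : is_derive t 1 (n.+1`!%:R^-1 *: (@id R ^+ n.+1))
    (n.+1`!%:R^-1 *: ((n.+1%:R * t ^+ n) *: 1)).
  exact: (@is_deriveZ _ _ _ (@id R ^+ n.+1)).
apply: (is_derive_eq H).
rewrite /pow_fact -[_ *: 1]/(_ * 1) -[_ *: _]/(_ * _) mulr1 factS natrM.
by rewrite invfM mulrACA mulVf ?pnatr_eq0// mul1r mulrC.
Qed.

Lemma is_derive_exp_poly n t : is_derive t 1 (exp_poly n) (exp_poly n.-1 t).
Proof.
elim: n => [|n IH].
  have -> : exp_poly 0 = cst 0 :> (R -> R).
    by apply/funext => x; rewrite exp_poly0.
  exact: is_derive_cst.
have -> : exp_poly n.+1 = exp_poly n + pow_fact n.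
  by apply/funext => x; rewrite exp_polyS.
case: n IH => [|n] IH.
  have -> : pow_fact 0 = cst 1 :> (R -> R).
    by apply/funext => x; rewrite /pow_fact expr0 fact0 divr1.
  by rewrite -[exp_poly 1.-1 t]addr0; exact: is_deriveD.
rewrite [_.-1]/= exp_polyS; apply: is_deriveD => //.
exact: is_derive_pow_fact.
Qed.

(** The functions [A_m = exp - P_m - P_(m-1)], which satisfy
    [A_m' = A_(m-1)] and [A_0 = exp]; the convention [0.-1 = 0] is harmless
    because [P_0 = 0]. *)
Definition exp_tail m t : R := expR t - exp_poly m t - exp_poly m.-1 t.

Lemma is_derive_exp_tail m t : is_derive t 1 (exp_tail m) (exp_tail m.-1 t).
Proof.
have -> : exp_tail m = expR - exp_poly m - exp_poly m.-1 by [].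
by apply: is_deriveB; [apply: is_deriveB|]; exact: is_derive_exp_poly.
Qed.

Lemma exp_tail_ge m t : 0 <= t -> - expR t <= exp_tail m t.
Proof.
move=> t0; rewrite /exp_tail.
by have := @exp_poly_le m t t0; have := @exp_poly_le m.-1 t t0; lra.
Qed.

Lemma exp_rem_le M t L : 0 <= t -> t <= L ->
  expR t - exp_poly M t <= expR L - exp_poly M L.
Proof.
move=> t0 tL.
apply: (@derive_ge0_le _ (fun t => expR t - exp_poly M t)
  (fun t => expR t - exp_poly M.-1 t)) => // x /andP[tx xL].
  have -> : (fun t => expR t - exp_poly M t) = expR - exp_poly M by [].
  by apply: is_deriveB; exact: is_derive_exp_poly.
by rewrite subr_ge0 exp_poly_le// (le_trans t0).
Qed.

(** Truncation at order [M] of the solution of [E_s = D], [D_t = E],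
    [E(0,t) = exp t], [D(s,s) = 0]. *)
Definition superE M s t : R := \sum_(m < M.+1) exp_tail m t * pow_fact m s.
Definition superD M s t : R := \sum_(m < M) exp_tail m.+1 t * pow_fact m s.

Lemma is_derive_superE M s t :
  is_derive s 1 (superE M ^~ t) (superD M s t).
Proof.
(* [dp n] is the derivative of [pow_fact n]. *)
pose dp n (s : R) := if n is k.+1 then pow_fact k s else 0.
have dpE n : is_derive s 1 (pow_fact n) (dp n s).
  case: n => [|n]; last exact: is_derive_pow_fact.
  have -> : pow_fact 0 = cst 1 :> (R -> R).
    by apply/funext => x; rewrite /pow_fact expr0 fact0 divr1.
  exact: is_derive_cst.
have -> : superD M s t = \sum_(m < M.+1) exp_tail m t * dp m s.
  by rewrite big_ord_recl /= mulr0 add0r.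
apply: (@is_derive_bigsum R _ (fun m s => exp_tail m t * pow_fact m s)
   (fun m s => exp_tail m t * dp m s)).
Qed.

(** The defect [exp_tail M t * pow_fact M s] is nonpositive once [M] is large,
    so that truncation yields a supersolution. *)
Lemma is_derive_superD M s t :
  is_derive t 1 (superD M s) (superE M s t - exp_tail M t * pow_fact M s).
Proof.
have -> : superE M s t - exp_tail M t * pow_fact M s =
    \sum_(m < M) exp_tail m t * pow_fact m s.
  by rewrite /superE big_ord_recr/= addrK.
apply: (@is_derive_bigsum R _ (fun m t => exp_tail m.+1 t * pow_fact m s)
   (fun m t => exp_tail m t * pow_fact m s)) => i.
have -> : (fun t => exp_tail i.+1 t * pow_fact i s) = pow_fact i s *: exp_tail i.+1.
  by apply/funext => x; rewrite /= mulrC.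
rewrite mulrC; apply: is_deriveZ; exact: is_derive_exp_tail.
Qed.

Lemma superE0 M t : superE M 0 t = expR t.
Proof.
rewrite /superE big_ord_recl big1 => [|i _].
  by rewrite addr0 /exp_tail/= exp_poly0 !subr0 /pow_fact expr0 fact0 divr1 mulr1.
by rewrite /pow_fact expr0n/= mul0r mulr0.
Qed.

Lemma superD_diag M s :
  superD M s s = exp_poly M s * (expR s - exp_poly M s).
Proof.
elim: M => [|M IH]; first by rewrite /superD big_ord0 exp_poly0 mul0r.
rewrite /superD big_ord_recr/= -/(superD M s s) IH /exp_tail/= exp_polyS.
ring.
Qed.

(** The last two sums are partial sums of the Bessel series [I_0(2t)] and
    [I_1(2t)]. *)
Lemma superE_diag M t :
  superE M t t = exp_poly M.+1 t * (expR t - exp_poly M.+1 t) +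
    (\sum_(m < M.+1) pow_fact m t ^+ 2
     + \sum_(m < M) pow_fact m.+1 t * pow_fact m t).
Proof.
elim: M => [|M IH].
  rewrite /superE !big_ord_recl !big_ord0 /exp_tail/= exp_polyS !exp_poly0.
  ring.
rewrite /superE big_ord_recr/= -/(superE M t t) IH /exp_tail/=.
rewrite [in RHS]big_ord_recr/= [X in _ = _ + (_ + X)]big_ord_recr/=.
rewrite !exp_polyS; ring.
Qed.

Lemma superE_ge M s t : 0 <= s -> 0 <= t -> - expR (s + t) <= superE M s t.
Proof.
move=> s0 t0.
have : \sum_(m < M.+1) (- expR t) * pow_fact m s <= superE M s t.
  apply: ler_sum => i _; apply: ler_wpM2r; first exact: pow_fact_ge0.
  exact: exp_tail_ge.
apply: le_trans.
rewrite -mulr_sumr mulNr lerN2 addrC expRD ler_wpM2l ?expR_ge0//.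
exact: (@exp_poly_le M.+1).
Qed.

End supersolution.

(** * The Bessel bound on the diagonal *)

Section bessel_bound.
Context (R : realType).
Implicit Types (x t l : R) (n : nat).

(** The remainder of the exponential series after [n] terms. *)
Let rem n x : R := expR x - exp_poly n x.

Let is_derive_rem n x : is_derive x 1 (rem n) (rem n.-1 x).
Proof.
have -> : rem n = expR - exp_poly n by [].
by apply: is_deriveB; exact: is_derive_exp_poly.
Qed.

Let rem0 n : rem n.+1 0 = 0.
Proof. by rewrite /rem expR0 exp_poly_at0 subrr. Qed.

(** A Taylor polynomial of odd degree of the exponential (or the zero
    polynomial, for [n = 0]) lies below it on the whole line. *)
Lemma exp_poly_even_le n x : exp_poly n.*2 x <= expR x.
Proof.
rewrite -subr_ge0 -/(rem _ _).
elim: n x => [|n IH] x; first by rewrite /rem exp_poly0 subr0 expR_ge0.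
(* The derivative of [rem n.*2.+1] is [rem n.*2], hence nonnegative, so
   [rem n.*2.+1] has the sign of its argument. *)
have pos y : 0 <= y -> 0 <= rem n.*2.+1 y.
  move=> y0; rewrite -(rem0 n.*2).
  by apply: (derive_ge0_le y0 (fun z _ => is_derive_rem _ z)) => z _; exact: IH.
have neg y : y <= 0 -> rem n.*2.+1 y <= 0.
  move=> y0; rewrite -(rem0 n.*2).
  by apply: (derive_ge0_le y0 (fun z _ => is_derive_rem _ z)) => z _; exact: IH.
rewrite doubleS -(rem0 n.*2.+1).
have [x0|/ltW x0] := leP 0 x.
  apply: (derive_ge0_le x0 (fun z _ => is_derive_rem _ z)) => z /andP[z0 _].
  exact: pos.
rewrite -lerN2.
apply: (@derive_ge0_le _ (- rem n.*2.+2) (fun z => - rem n.*2.+1 z) _ _ x0).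
  by move=> z _; apply: is_deriveN; exact: is_derive_rem.
by move=> z /andP[_ z0]; rewrite oppr_ge0; exact: neg.
Qed.

(** The mean value of [cos ^+ n] on [[0, pi]]. *)
Definition wallis n : R :=
  if odd n then 0 else n`!%:R / (2 ^+ n * n./2`!%:R ^+ 2).

Lemma wallisSS n : wallis n.+2 = n.+1%:R / n.+2%:R * wallis n.
Proof.
rewrite /wallis /= negbK; case: ifP => on; first by rewrite mulr0.
have nE : n = n./2.*2 by rewrite -[LHS]odd_double_half on.
set k := n./2 in nE *.
have k0 : k.+1%:R != 0 :> R by rewrite pnatr_eq0.
have fk0 : k`!%:R != 0 :> R by rewrite pnatr_eq0 -lt0n fact_gt0.
rewrite !factS !natrM.
have -> : n.+2%:R = 2 * k.+1%:R :> R by rewrite nE -natrM mul2n doubleS.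
rewrite !exprS.
field.
by rewrite fk0 expf_neq0//= addrC natr1.
Qed.

(** The recursion is the usual integration by parts of [cos ^+ n.+2]. *)
Lemma cos_power_antiderivative n : exists C : R -> R,
  [/\ (forall x, is_derive x 1 C (cos x ^+ n)), C 0 = 0 & C pi = pi * wallis n].
Proof.
suff : (exists C : R -> R,
  [/\ (forall x, is_derive x 1 C (cos x ^+ n)), C 0 = 0 & C pi = pi * wallis n]) /\
  (exists C : R -> R,
  [/\ (forall x, is_derive x 1 C (cos x ^+ n.+1)), C 0 = 0 &
     C pi = pi * wallis n.+1]) by case.
elim: n => [|n [[C [dC C0 Cpi]] IH1]].
  split.
    exists id; split => //; first by move=> x; rewrite expr0; exact: is_derive_id.
    by rewrite /wallis /= fact0 expr1n !mulr1 expr0 divr1 mulr1.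
  exists sin; split => [x||]; rewrite ?expr1 ?sin0// ?sinpi /wallis ?mulr0//.
  exact: is_derive_sin.
split => //.
have n20 : n.+2%:R != 0 :> R by rewrite pnatr_eq0.
exists (fun x => n.+2%:R^-1 * (sin x * cos x ^+ n.+1 + n.+1%:R * C x)); split.
- move=> x.
  have -> : (fun x => n.+2%:R^-1 * (sin x * cos x ^+ n.+1 + n.+1%:R * C x)) =
      n.+2%:R^-1 *: (sin * cos ^+ n.+1 + n.+1%:R *: C).
    apply/funext => y.
    rewrite -[RHS]/(n.+2%:R^-1 * (sin y * (cos ^+ n.+1) y + n.+1%:R * C y)).
    by rewrite exprfctE.
  have H := @is_deriveZ _ _ _ _ (n.+2%:R^-1) x 1 _ (@is_deriveD _ _ _ _ _ x 1 _ _
    (@is_deriveM _ _ _ _ x 1 _ _ (is_derive_sin x)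
        (@is_deriveX _ _ _ n.+1 x 1 _ (is_derive_cos x)))
    (@is_deriveZ _ _ _ C n.+1%:R x 1 _ (dC x))).
  apply: (is_derive_eq H).
  rewrite exprfctE /GRing.scale/= !exprS.
  have -> : sin x * (n.+1%:R * cos x ^+ n * - sin x) =
      n.+1%:R * cos x ^+ n * (cos x ^+ 2 - 1).
    by rewrite -(cos2Dsin2 x); ring.
  by field; rewrite -natrD.
- by rewrite sin0 mul0r C0 mulr0 addr0 mulr0.
- by rewrite wallisSS sinpi mul0r add0r Cpi; ring.
Qed.

Lemma exp_cos_antiderivative l n : exists C : R -> R,
  [/\ (forall x, is_derive x 1 C (exp_poly n (l * cos x) * (1 + cos x))),
      C 0 = 0 &
      C pi = pi * \sum_(k < n) pow_fact k l * (wallis k + wallis k.+1)].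
Proof.
elim: n => [|n [C [dC C0 Cpi]]].
  exists (cst 0); split=> [x||]; rewrite ?big_ord0 ?mulr0//.
  by rewrite exp_poly0 mul0r; exact: is_derive_cst.
have [A [dA A0 Api]] := cos_power_antiderivative n.
have [B [dB B0 Bpi]] := cos_power_antiderivative n.+1.
exists (C + pow_fact n l *: (A + B)); split.
- move=> x.
  have H := @is_deriveD _ _ _ _ _ x 1 _ _ (dC x)
    (@is_deriveZ _ _ _ _ (pow_fact n l) x 1 _
      (@is_deriveD _ _ _ _ _ x 1 _ _ (dA x) (dB x))).
  apply: (is_derive_eq H).
  by rewrite exp_polyS /GRing.scale/= /pow_fact exprMn exprS; ring.
- rewrite -[LHS]/(C 0 + pow_fact n l * (A 0 + B 0)) C0 A0 B0.
  by rewrite !addr0 mulr0 ?addr0.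
- rewrite -[LHS]/(C pi + pow_fact n l * (A pi + B pi)) Cpi Api Bpi.
  by rewrite big_ord_recr/=; ring.
Qed.

(** The terms [k = 2m] and [k = 2m + 1] give [(t^m/m!)^2] and
    [t^(2m+1)/(m! (m+1)!)]; odd Wallis means vanish. *)
Lemma wallis_sum t M :
  \sum_(k < M.*2) pow_fact k (2 * t) * (wallis k + wallis k.+1) =
  \sum_(m < M) (pow_fact m t ^+ 2 + pow_fact m.+1 t * pow_fact m t).
Proof.
elim: M => [|M IH]; first by rewrite !big_ord0.
rewrite doubleS big_ord_recr/= big_ord_recr/= IH big_ord_recr/= -addrA.
congr (_ + _).
have f0 k : k`!%:R != 0 :> R by rewrite pnatr_eq0 -lt0n fact_gt0.
have p0 k : 2 ^+ k != 0 :> R by rewrite expf_neq0.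
rewrite /wallis /= odd_double /= add0r addr0; congr (_ + _).
  rewrite doubleK /pow_fact exprMn -muln2 exprM (exprM t).
  by field; rewrite p0 !f0.
rewrite doubleK /pow_fact exprMn !factS !natrM.
have M0 : M.+1%:R != 0 :> R by rewrite pnatr_eq0.
have -> : M.*2.+2%:R = 2 * M.+1%:R :> R by rewrite -natrM mul2n doubleS.
rewrite !exprS -muln2 exprM (exprM t).
field.
by rewrite p0 !f0 -natrM ![1 + _]addrC !natr1 !pnatr_eq0.
Qed.

Lemma gauss_antiderivative : exists G : R -> R,
  (forall x, is_derive x 1 G (gauss_fun x)) /\
  (forall x, 0 <= x -> G x - G 0 <= Num.sqrt pi / 2).
Proof.
pose mu := @lebesgue_measure R.
have gi (i : interval R) : mu.-integrable [set` i] (EFin \o gauss_fun).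
  exact: (integrableS measurableT _ (@subsetT _ _) integrableT_gauss).
pose G (x : R) := \int[mu]_(t in [set` Interval -oo%O (BRight x)]) gauss_fun t.
exists G; split => x.
  have := @continuous_FTC1 R gauss_fun -oo%O x (x + 1).
  rewrite ltrDl ltr01 => /(_ erefl (gi _) (ltNyr _)) [|dG GE].
    exact: continuous_gauss_fun.
  apply: DeriveDef; first exact: dG.
  by rewrite -derive1E.
move=> x0; rewrite /G (@Rintegral_itvB _ _ -oo%O (BRight x) 0 (gi _)) ?bnd_simp//.
rewrite -lee_fin -integral0y_gauss /Rintegral fineK; last first.
  exact: integrable_fin_num.
apply: ge0_subset_integral => //.
- exact: (measurable_int mu (gi _)).
- by move=> y _; rewrite lee_fin gauss_fun_ge0.
- by move=> y /=; rewrite !in_itv/= andbT => /andP[/ltW].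
Qed.

(** Partial sums of [I_0(2t) + I_1(2t)] are at most
    [exp(2t) / sqrt(pi t)]. *)
Lemma bessel_sum_le t M : 0 < t ->
  \sum_(m < M.+1) pow_fact m t ^+ 2 + \sum_(m < M) pow_fact m.+1 t * pow_fact m t
  <= expR (2 * t) / Num.sqrt (pi * t).
Proof.
move=> t0.
have [G [dG Gle]] := gauss_antiderivative.
have [C [dC C0 Cpi]] := exp_cos_antiderivative (2 * t) M.+1.*2.
set s := 2 * Num.sqrt t.
have st0 : 0 < Num.sqrt t by rewrite sqrtr_gt0.
have s0 : 0 < s by rewrite mulr_gt0.
have s2 : s ^+ 2 = 4 * t.
  by rewrite exprMn sqr_sqrtr ?ltW// -natrX.
(* [Q] is an antiderivative of [q]: the Gaussian primitive composed with
   [x |-> s * sin (x / 2)], since [2t cos x = 2t - (s * sin (x / 2))^2]. *)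
pose Q (x : R) := expR (2 * t) * (4 / s) * G (s * sin (x / 2)).
pose q (x : R) := 2 * cos (x / 2) * expR (2 * t * cos x).
have cosE x : cos x = 2 * cos (x / 2) ^+ 2 - 1.
  by rewrite {1}(splitr x) -mulr2n cos_mulr2n mulr_natl.
have dQ x : is_derive x 1 Q (q x).
  have H1 : is_derive x 1 (2^-1 *: @id R) (2^-1 *: 1) by exact: is_deriveZ.
  have H2 := @is_derive1_comp _ sin _ x _ _ (is_derive_sin _) H1.
  have H3 := @is_deriveZ _ _ _ _ s x 1 _ H2.
  have H4 := @is_derive1_comp _ G _ x _ _ (dG _) H3.
  have H5 := @is_deriveZ _ _ _ _ (expR (2 * t) * (4 / s)) x 1 _ H4.
  have -> : Q = (expR (2 * t) * (4 / s)) *: (G \o (s *: (sin \o (2^-1 *: @id R)))).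
    apply/funext => y; rewrite /Q.
    rewrite -[RHS]/(expR (2 * t) * (4 / s) * G (s * sin (2^-1 * y))).
    by rewrite (mulrC y).
  apply: (is_derive_eq H5).
  rewrite -[LHS]/(expR (2 * t) * (4 / s) *
    (gauss_fun (s * sin (2^-1 * x)) * (s * (cos (2^-1 * x) * (2^-1 * 1))))).
  rewrite /q /gauss_fun (mulrC _ x) exprMn s2.
  rewrite (_ : 2 * t * cos x = 2 * t + - (4 * t * sin (x / 2) ^+ 2)).
    by rewrite expRD; field; rewrite gt_eqF.
  by rewrite cosE sin2cos2; ring.
have key : Q 0 - C 0 <= Q pi - C pi.
  apply: (@derive_ge0_le _ (Q - C)
    (fun x => q x - exp_poly M.+1.*2 (2 * t * cos x) * (1 + cos x))).
  - exact: pi_ge0.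
  move=> x /andP[x0 xpi].
  have c1 : cos (x / 2) <= 1 by exact: cos_le1.
  have c0 : 0 <= cos (x / 2).
    by apply: cos_ge0_pihalf; apply/andP; split; lra.
  rewrite subr_ge0 /q (mulrC _ (expR _)).
  have e := exp_poly_even_le M.+1 (2 * t * cos x).
  have h0 : 0 <= 1 + cos x by have := cos_geN1 x; lra.
  apply: (le_trans (ler_wpM2r h0 e)).
  apply: ler_wpM2l; first exact: expR_ge0.
  rewrite {1}cosE expr2; nra.
have Csum : \sum_(m < M.+1) pow_fact m t ^+ 2 +
    \sum_(m < M) pow_fact m.+1 t * pow_fact m t <= C pi / pi.
  rewrite Cpi mulrC mulKf ?gt_eqF ?pi_gt0// wallis_sum big_split/= lerD2l.
  rewrite [leRHS]big_ord_recr/= lerDl mulr_ge0// pow_fact_ge0// ltW//.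
apply: (le_trans Csum).
rewrite ler_pdivrMr ?pi_gt0//.
have : C pi <= Q pi - Q 0 by move: key; rewrite C0; lra.
move=> /le_trans; apply.
rewrite /Q mul0r sin0 mulr0 sin_pihalf mulr1 -mulrBr.
have p0 : 0 < Num.sqrt pi :> R by rewrite sqrtr_gt0 pi_gt0.
have K0 : 0 <= expR (2 * t) * (4 / s).
  by rewrite mulr_ge0 ?expR_ge0// divr_ge0// ltW.
apply: (le_trans (ler_wpM2l K0 (Gle s (ltW s0)))).
rewrite sqrtrM ?pi_ge0// -[X in _ <= _ * X](sqr_sqrtr (pi_ge0 R)) /s.
rewrite le_eqVlt; apply/orP; left; apply/eqP.
by field; rewrite !gt_eqF.
Qed.

End bessel_bound.

(** * Bounds for the residual *)

Section profiles.
Context (R : realType).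
Implicit Types (s t L delta : R) (M : nat).

(** Truncation of the solution of the unforced system for which [e] is [1] at
    [s = 0] and [d] vanishes on the diagonal. *)
Definition profE M s t : R := expR (- (s + t)) * superE M s t.
Definition profD M s t : R := expR (- (s + t)) * superD M s t.

Let is_derive_expRN (c x : R) :
  is_derive x 1 (fun y => expR (- (c + y))) (- expR (- (c + x))).
Proof.
have -> : (fun y : R => expR (- (c + y))) = expR \o (- (cst c + @id R)) by [].
have H : is_derive x 1 (- (cst c + @id R)) (- (0 + 1)).
  by apply: is_deriveN; exact: is_deriveD.
have H2 := @is_derive1_comp _ expR _ x _ _ (is_derive_expR _) H.
by apply: (is_derive_eq H2); rewrite add0r mulrN1.
Qed.

Lemma is_derive_profE M s t :
  is_derive s 1 (profE M ^~ t) (profD M s t - profE M s t).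
Proof.
have -> : profE M ^~ t = (fun y => expR (- (t + y))) * (superE M ^~ t).
  by apply/funext => y; rewrite /profE addrC.
have H := @is_deriveM _ _ _ _ s 1 _ _ (is_derive_expRN t s) (is_derive_superE M s t).
apply: (is_derive_eq H); rewrite /profD /profE /GRing.scale/= (addrC s); ring.
Qed.

Lemma is_derive_profD M s t :
  is_derive t 1 (profD M s) (profE M s t - profD M s t
    - expR (- (s + t)) * (exp_tail M t * pow_fact M s)).
Proof.
have H := @is_deriveM _ _ _ _ t 1 _ _ (is_derive_expRN s t) (is_derive_superD M s t).
by apply: (is_derive_eq H); rewrite /profD /profE /GRing.scale/=; ring.
Qed.

Lemma profE0 M t : profE M 0 t = 1.
Proof. by rewrite /profE superE0 add0r expRN mulVf ?gt_eqF ?expR_gt0//. Qed.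

Lemma profD_diag_ge0 M s : 0 <= s -> 0 <= profD M s s.
Proof.
move=> s0; rewrite /profD superD_diag mulr_ge0 ?expR_ge0// mulr_ge0 ?exp_poly_ge0//.
by rewrite subr_ge0 exp_poly_le.
Qed.

Lemma profE_geN1 M s t : 0 <= s -> 0 <= t -> - 1 <= profE M s t.
Proof.
move=> s0 t0; have := ler_wpM2l (expR_ge0 (- (s + t))) (superE_ge M s0 t0).
by rewrite /profE mulrN expRN mulVf ?gt_eqF ?expR_gt0//.
Qed.

(** On a bounded time interval a large truncation order makes the profile both
    a supersolution and, on the diagonal, close to the Bessel bound. *)
Lemma profile_exists L delta : 0 <= L -> 0 < delta -> exists M,
  (forall t, 0 <= t <= L -> exp_tail M t <= 0) /\
  (forall t, 0 < t <= L -> profE M t t <= (Num.sqrt (pi * t))^-1 + delta).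
Proof.
move=> L0 delta0.
have [n0 _ Hn] : \forall n \near \oo, expR L - exp_poly n L <= Num.min 1 delta.
  have cv : expR L - exp_poly n L @[n --> \oo] --> expR L - expR L.
    by apply: cvgB; [exact: cvg_cst|exact: exp_poly_cvg].
  rewrite subrr in cv.
  by apply: (cvgr_le _ cv); rewrite lt_min ltr01.
exists n0.+2; split=> t /andP[t0 tL].
  have h1 : expR L - exp_poly n0.+1 L <= 1.
    have : expR L - exp_poly n0.+1 L <= Num.min 1 delta by apply: Hn => /=.
    by rewrite le_min => /andP[].
  have h2 := exp_rem_le n0.+1 t0 tL.
  have h3 := exp_poly_ge1 n0 t0.
  have h4 := pow_fact_ge0 n0.+1 t0.
  rewrite /exp_tail [_.-1]/= (exp_polyS n0.+1); lra.
have {}t0' := ltW t0.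
have h1 : expR L - exp_poly n0.+3 L <= delta.
  have : expR L - exp_poly n0.+3 L <= Num.min 1 delta.
    by apply: Hn => /=; rewrite ltnW// ltnW.
  by rewrite le_min => /andP[].
have h2 := exp_rem_le n0.+3 t0' tL.
have h3 := exp_poly_le n0.+3 t0'.
have h4 := exp_poly_ge0 n0.+3 t0'.
have h5 := bessel_sum_le n0.+2 t0.
rewrite /profE superE_diag mulrDr addrC; apply: lerD.
  have := ler_wpM2l (expR_ge0 (- (t + t))) h5.
  by rewrite mulrA -expRD -mulr2n mulr_natl addNr expR0 mul1r.
have h6 : exp_poly n0.+3 t * (expR t - exp_poly n0.+3 t) <= expR t * delta.
  by apply: ler_pM => //; [rewrite subr_ge0|lra].
apply: (le_trans (ler_wpM2l (expR_ge0 (- (t + t))) h6)).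
rewrite mulrA -expRD opprD addrNK -[leRHS]mul1r ler_pM2r//.
by rewrite expR_le1 oppr_le0.
Qed.

End profiles.

Section stages.
Context (R : realType) (X : completeNormedModType R).
Variables (T : X -> X) (f : R -> X) (x0 : X) (u : R -> X) (eps : R -> R).
Hypothesis T_nonexp : nonexpansive T.
Hypothesis u_sol : is_solution T f x0 u.
Hypothesis eps_f : forall t : R, 0 <= t -> `|f t| <= eps t.
Variable N : R -> R.
Hypothesis N0 : N 0 = 0.
Hypothesis eps_ge0 : forall t : R, 0 <= t -> 0 <= eps t.
Hypothesis eps_decr : forall s t : R, 0 <= s -> s <= t -> eps t <= eps s.
Hypothesis eps_right : forall t : R, 0 <= t -> eps y @[y --> t^'+] --> eps t.
Hypothesis N_ge : forall t y : R, 0 <= t <= y -> (y - t) * eps y <= N y - N t.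
Hypothesis N_le : forall t y : R, 0 <= t <= y -> N y - N t <= (y - t) * eps t.

Let N_mono (t y : R) : 0 <= t <= y -> N t <= N y.
Proof.
move=> /[dup] ty /N_ge; case/andP: ty => t0 ty.
move=> H; rewrite -subr_ge0 (le_trans _ H)// mulr_ge0 ?subr_ge0//.
by apply: eps_ge0; exact: le_trans ty.
Qed.

Let N_left (t : R) : 0 < t -> N y @[y --> t^'-] --> N t.
Proof.
move=> t0.
have cv : (t - y) * eps 0 @[y --> t^'-] --> (t - t) * eps 0.
  apply: cvgM; last exact: cvg_cst.
  by apply: cvgB; [exact: cvg_cst|exact: cvg_at_left_filter].
apply/cvgrPdist_le => e e0.
have H : \forall y \near t^'-, (t - y) * eps 0 <= e.
  by apply: (cvgr_le _ cv); rewrite subrr mul0r.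
near=> y.
have yt : y <= t by near: y; exact: nbhs_left_le.
have y0 : 0 <= y by near: y; exact: nbhs_left_ge.
have He : (t - y) * eps 0 <= e by near: y; exact: H.
have yt' : 0 <= y <= t by rewrite y0 yt.
rewrite ger0_norm; last by rewrite subr_ge0; exact: N_mono.
apply: (le_trans (N_le yt')); apply: le_trans He.
by rewrite ler_wpM2l ?subr_ge0//; exact: eps_decr.
Unshelve. all: by end_near. Qed.

Variables (p : X) (M : nat) (L : R).
Hypothesis Tp : Fix T p.
Hypothesis L0 : 0 <= L.
Hypothesis M_tail : forall t : R, 0 <= t <= L -> exp_tail M t <= 0.
Let r := `|x0 - p|.

(** The comparison principle on [a <= s <= t <= L], with a supersolution made
    of the profile started at [0], carrying the initial distance, the profile
    restarted at [a] with amplitude [c], and the mass of [eps]. *)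
Lemma residual_le_profile (a c : R) : 0 <= a -> a <= L -> 0 <= c ->
  (forall t : R, a <= t -> t <= L ->
     `|u a - T (u t)| <= 2 * r * profE M a t + c + (N t - N a)) ->
  forall s t : R, a <= s -> s <= t -> t <= L ->
    `|u s - T (u t)| <= 2 * r * profE M s t + c * profE M (s - a) (t - a)
       + (N s + N t - 2 * N a).
Proof.
move=> a0 aL c0 Ea.
have r0 : 0 <= r by exact: normr_ge0.
pose E (s t : R) : R := 2 * r * profE M s t + c * profE M (s - a) (t - a)
       + (N s + N t - 2 * N a).
pose D (s t : R) : R := 2 * r * profD M s t + c * profD M (s - a) (t - a)
       + (N s + N t - 2 * N a).
pose g (s t : R) : R := exp_tail M t * pow_fact M s * expR (- (s + t)).
have g0 (s t : R) : 0 <= s -> 0 <= t <= L -> g s t <= 0.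
  move=> s0 t0L; rewrite /g mulr_le0_ge0 ?expR_ge0// mulr_le0_ge0 ?pow_fact_ge0//.
  exact: M_tail.
have shiftd (F : R -> R) (x v : R) :
    is_derive (x - a) 1 F v -> is_derive x 1 (fun y => F (y - a)) v.
  move=> H.
  have H1 : is_derive x 1 (@id R - cst a) (1 - 0) by exact: is_deriveB.
  have H2 := @is_derive1_comp _ F _ x _ _ H H1.
  by apply: (is_derive_eq H2); rewrite subr0 mulr1.
have comb (F G : R -> R) (x v w : R) : is_derive x 1 F v -> is_derive x 1 G w ->
    is_derive x 1 (fun y => 2 * r * F y + c * G y) (2 * r * v + c * w).
  move=> dF dG.
  exact: (@is_deriveD _ _ _ _ _ x 1 _ _ (@is_deriveZ _ _ _ F (2 * r) x 1 _ dF)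
     (@is_deriveZ _ _ _ G c x 1 _ dG)).
have dE (s t : R) : is_derive s 1
    (fun y => 2 * r * profE M y t + c * profE M (y - a) (t - a))
    (2 * r * (profD M s t - profE M s t) +
     c * (profD M (s - a) (t - a) - profE M (s - a) (t - a))).
  apply: comb; first exact: is_derive_profE.
  by apply: (shiftd (profE M ^~ (t - a))); exact: is_derive_profE.
have dD (s t : R) : is_derive t 1
    (fun y => 2 * r * profD M s y + c * profD M (s - a) (y - a))
    (2 * r * (profE M s t - profD M s t
        - expR (- (s + t)) * (exp_tail M t * pow_fact M s)) +
     c * (profE M (s - a) (t - a) - profD M (s - a) (t - a)
        - expR (- ((s - a) + (t - a))) * (exp_tail M (t - a) * pow_fact M (s - a)))).
  apply: comb; first exact: is_derive_profD.
  by apply: (shiftd (profD M (s - a))); exact: is_derive_profD.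
apply: (@comparison _ _ T f x0 u eps T_nonexp u_sol eps_f a L a0 aL E D _ _ _ _ _ _
   (4 * r + c + 2 * N a)).
- move=> s t as_ st tL; rewrite /D.
  apply: cvgD; first exact: (derive_cvg_left (dD s t)).
  apply: cvgB; last exact: cvg_cst.
  apply: cvgD; first exact: cvg_cst.
  by apply: N_left; lra.
- move=> s t as_ st tL; rewrite /E.
  apply: cvgD; first exact: (derive_cvg_left (dE s t)).
  apply: cvgB; last exact: cvg_cst.
  apply: cvgD; last exact: cvg_cst.
  by apply: N_left; lra.
- move=> s t eta as_ st tL eta0.
  have eta20 : 0 < eta / 2 by rewrite divr_gt0.
  have t0 : 0 <= t by lra.
  have H1 := derive_expansion (dD s t) eta20.
  have H2 := N_expansion eps_right N_ge t0 eta20.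
  near=> y.
  have ty : t <= y by near: y; exact: nbhs_right_ge.
  have h2 : N t + (y - t) * (eps t - eta / 2) <= N y by near: y; exact: H2.
  have : `|(2 * r * profD M s y + c * profD M (s - a) (y - a))
     - (2 * r * profD M s t + c * profD M (s - a) (t - a)) - (y - t) *:
    (2 * r * (profE M s t - profD M s t
        - expR (- (s + t)) * (exp_tail M t * pow_fact M s)) +
     c * (profE M (s - a) (t - a) - profD M (s - a) (t - a)
        - expR (- ((s - a) + (t - a))) * (exp_tail M (t - a) * pow_fact M (s - a))))|
    <= eta / 2 * (y - t) by near: y; exact: H1.
  rewrite ler_norml => /andP[h1 _].
  have k1 : 2 * r * g s t * (y - t) <= 0.
    apply: mulr_le0_ge0; last by rewrite subr_ge0.
    apply: mulr_ge0_le0; first by rewrite mulr_ge0.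
    by apply: g0; lra.
  have k2 : c * g (s - a) (t - a) * (y - t) <= 0.
    apply: mulr_le0_ge0; last by rewrite subr_ge0.
    by apply: mulr_ge0_le0 => //; apply: g0; lra.
  move: h1; rewrite /GRing.scale/= => h1.
  rewrite /D /E; move: k1 k2; rewrite /g => k1 k2; lra.
- move=> s t eta as_ st tL eta0.
  have eta20 : 0 < eta / 2 by rewrite divr_gt0.
  have s0 : 0 <= s by lra.
  have H1 := derive_expansion (dE s t) eta20.
  have H2 := N_expansion eps_right N_ge s0 eta20.
  near=> y.
  have ty : s <= y by near: y; exact: nbhs_right_ge.
  have h2 : N s + (y - s) * (eps s - eta / 2) <= N y by near: y; exact: H2.
  have : `|(2 * r * profE M y t + c * profE M (y - a) (t - a))
     - (2 * r * profE M s t + c * profE M (s - a) (t - a)) - (y - s) *: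
    (2 * r * (profD M s t - profE M s t) +
     c * (profD M (s - a) (t - a) - profE M (s - a) (t - a)))|
    <= eta / 2 * (y - s) by near: y; exact: H1.
  rewrite ler_norml => /andP[h1 _].
  move: h1; rewrite /GRing.scale/= => h1.
  rewrite /D /E; lra.
- move=> s /andP[as_ sL]; rewrite /D.
  have h1 : N a <= N s by apply: N_mono; rewrite a0.
  have h2 : 0 <= 2 * r * profD M s s.
    apply: mulr_ge0; first by rewrite mulr_ge0.
    by apply: profD_diag_ge0; lra.
  have h3 : 0 <= c * profD M (s - a) (s - a).
    by apply: mulr_ge0 => //; apply: profD_diag_ge0; lra.
  lra.
- move=> t /andP[at_ tL]; rewrite /E subrr profE0.
  by apply: (le_trans (Ea t at_ tL)); lra.
move=> s t as_ st tL.
have hs : `|u s - p| <= r + N s.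
  apply: (solution_bound T_nonexp u_sol eps_f N0 eps_right N_left N_ge Tp); lra.
have ht : `|u t - p| <= r + N t.
  apply: (solution_bound T_nonexp u_sol eps_f N0 eps_right N_left N_ge Tp); lra.
have hT : `|T (u t) - p| <= `|u t - p| by rewrite -{1}Tp; exact: T_nonexp.
have h : `|u s - T (u t)| <= `|u s - p| + `|T (u t) - p|.
  by rewrite (distrC (T (u t))); exact: ler_distD.
have e1 : - (2 * r) <= 2 * r * profE M s t.
  have : 2 * r * -1 <= 2 * r * profE M s t.
    by apply: ler_wpM2l; [rewrite mulr_ge0|apply: profE_geN1; lra].
  by rewrite mulrN1.
have e2 : - c <= c * profE M (s - a) (t - a).
  have : c * -1 <= c * profE M (s - a) (t - a).
    by apply: ler_wpM2l => //; apply: profE_geN1; lra.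
  by rewrite mulrN1.
rewrite /E; lra.
Unshelve. all: by end_near. Qed.

(** Two uses of the comparison: on [[0, L]] with [c = 0], then on [[h, L]] with
    [c = 2 * N h], twice the mass of [eps] on [[0, h]]. *)
Lemma residual_bound (h : R) : 0 < h -> h <= L ->
  `|u L - T (u L)| <= 2 * r * profE M L L + 2 * N h * profE M (L - h) (L - h)
    + 2 * (N L - N h).
Proof.
move=> h0 hL.
have st1 : forall s t : R, 0 <= s -> s <= t -> t <= L ->
    `|u s - T (u t)| <= 2 * r * profE M s t + (N s + N t).
  move=> s t s0 st tL.
  have := @residual_le_profile 0 0 (lexx _) L0 (lexx _).
  have Ea (t' : R) : 0 <= t' -> t' <= L ->
     `|u 0 - T (u t')| <= 2 * r * profE M 0 t' + 0 + (N t' - N 0).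
    move=> t0' tL'; rewrite profE0 N0 subr0 addr0 mulr1.
    have ht : `|u t' - p| <= r + N t'.
      exact: (solution_bound T_nonexp u_sol eps_f N0 eps_right N_left N_ge Tp).
    have hT : `|T (u t') - p| <= `|u t' - p| by rewrite -{1}Tp; exact: T_nonexp.
    have : `|u 0 - T (u t')| <= `|u 0 - p| + `|T (u t') - p|.
      by rewrite (distrC (T (u t'))); exact: ler_distD.
    have -> : u 0 = x0 by case: u_sol.
    rewrite -/r; lra.
  move=> /(_ Ea s t s0 st tL).
  by rewrite N0 mulr0 !subr0 mul0r addr0.
have Nh0 : 0 <= N h by rewrite -N0; apply: N_mono; rewrite lexx ltW.
have hh := ltW h0.
have := @residual_le_profile h (2 * N h) hh hL _ _ L L hL (lexx _) (lexx _).
have -> : N L + N L - 2 * N h = 2 * (N L - N h) by lra.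
apply; first by rewrite mulr_ge0.
move=> t ht tL.
apply: (le_trans (st1 h t hh ht tL)); lra.
Qed.

End stages.

(** * Integrals of nonincreasing functions on a half-line *)

Section half_line_integrals.
Context (R : realType).
Notation mu := (@lebesgue_measure R).
Implicit Types (g phi : R -> R) (A B : set R).

Lemma ge0_integrable_half_line g :
  measurable_fun (`[0, +oo[%classic : set R) g ->
  (forall t : R, 0 <= t -> 0 <= g t) ->
  (\int[mu]_(t in `[0%R, +oo[) (g t)%:E < +oo)%E ->
  mu.-integrable `[0%R, +oo[ (EFin \o g).
Proof.
move=> mg g0 gfin; apply/integrableP; split; first exact/measurable_EFinP.
apply: le_lt_trans gfin; rewrite le_eqVlt; apply/orP; left; apply/eqP.
apply: eq_integral => t; rewrite inE/= in_itv/= andbT => t0.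
by rewrite ger0_norm// g0.
Qed.

Lemma ge0_subset_Rintegral A B g : measurable A -> measurable B -> A `<=` B ->
  mu.-integrable B (EFin \o g) -> (forall t, B t -> 0 <= g t) ->
  \int[mu]_(t in A) g t <= \int[mu]_(t in B) g t.
Proof.
move=> mA mB AB ig g0; rewrite /Rintegral fine_le//.
- by apply: integrable_fin_num => //; exact: integrableS ig.
- exact: integrable_fin_num.
- apply: ge0_subset_integral => //; first exact: (measurable_int mu ig).
Qed.

Lemma nondecreasing_measurable_half_line phi :
  (forall s t : R, 0 <= s -> s <= t -> phi s <= phi t) ->
  measurable_fun (`[0, +oo[%classic : set R) phi.
Proof.
move=> phi_nd.
(* Freezing [phi] at [phi 0] on negative arguments makes it monotone on the
   whole line. *)
apply: (eq_measurable_fun (fun x : R => phi (Num.max 0 x))).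
  by move=> x; rewrite inE/= in_itv/= andbT => x0; rewrite (max_idPr x0).
apply: nondecreasing_measurable => // x y xy.
apply: phi_nd; first by rewrite le_max lexx.
by rewrite ge_max !le_max lexx xy orbT.
Qed.

(** A Markov-type inequality for a nondecreasing weight. *)
Lemma weighted_tail_le phi g (h : R) :
  measurable_fun (`[0, +oo[%classic : set R) g ->
  (forall t : R, 0 <= t -> 0 <= g t) ->
  mu.-integrable `[0%R, +oo[ (EFin \o g) ->
  (forall s : R, 0 <= s -> 0 <= phi s) ->
  (forall s t : R, 0 <= s -> s <= t -> phi s <= phi t) ->
  (\int[mu]_(s in `[0%R, +oo[) (phi s * g s)%:E < +oo)%E ->
  0 <= h ->
  phi h * \int[mu]_(s in `[h, +oo[) g s <=
    \int[mu]_(s in `[0, +oo[) (phi s * g s).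
Proof.
move=> mg g0 ig phi0 phi_nd fin h0.
have sub : (`[h, +oo[%classic : set R) `<=` `[0, +oo[%classic.
  by apply: subset_itvr; rewrite bnd_simp.
have igh : mu.-integrable `[h, +oo[ (EFin \o g) by exact: integrableS ig.
have ip : mu.-integrable `[0%R, +oo[ (EFin \o (fun s => phi s * g s)).
  apply: ge0_integrable_half_line fin.
    by apply: measurable_funM => //; exact: nondecreasing_measurable_half_line.
  by move=> t t0; rewrite mulr_ge0 ?phi0 ?g0.
rewrite -RintegralZl//.
apply: (@le_trans _ _ (\int[mu]_(s in `[h, +oo[) (phi s * g s))).
  apply: le_Rintegral => //.
  - have -> : EFin \o (fun x => phi h * g x) =
        (fun x => (phi h)%:E * (EFin \o g) x)%E by [].
    exact: integrableZl.
  - exact: integrableS ip.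
  - move=> x /=; rewrite in_itv/= andbT => hx.
    by rewrite ler_wpM2r ?phi_nd// g0// (le_trans h0).
apply: ge0_subset_Rintegral => //.
by move=> t /=; rewrite in_itv/= andbT => t0; rewrite mulr_ge0 ?phi0 ?g0.
Qed.

Section primitive.
Variable eps : R -> R.
Hypothesis eps_ge0 : forall t : R, 0 <= t -> 0 <= eps t.
Hypothesis eps_decr : forall s t : R, 0 <= s -> s <= t -> eps t <= eps s.
Hypothesis eps_int : mu.-integrable `[0%R, +oo[ (EFin \o eps).

Let N (t : R) := \int[mu]_(s in `[0, t]) eps s.

Lemma primitive_at0 : N 0 = 0.
Proof. by rewrite /N set_itv1 Rintegral_set1. Qed.

Lemma primitiveB (t y : R) : 0 <= t <= y ->
  N y - N t = \int[mu]_(s in `]t, y]) eps s.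
Proof.
move=> /andP[t0 ty]; rewrite /N Rintegral_itvB ?bnd_simp//.
apply: integrableS eps_int => //.
by move=> s /=; rewrite !in_itv/= andbT => /andP[].
Qed.

Let int_oc (t y : R) : 0 <= t -> mu.-integrable `]t, y] (EFin \o eps).
Proof.
move=> t0; apply: integrableS eps_int => //.
by move=> s /=; rewrite !in_itv/= andbT => /andP[ts _]; rewrite ltW// (le_lt_trans t0).
Qed.

Let int_cst (t y c : R) : mu.-integrable `]t, y] (EFin \o cst c).
Proof.
apply: measurable_bounded_integrable => //.
- by rewrite /= lebesgue_measure_itv/=; case: ifP => //= _; rewrite -EFinB ltry.
- exists `|c|; split; first exact: normr_real.
  by move=> z cz x _ /=; exact: ltW.
Qed.

Let cst_oc (t y c : R) : t <= y -> \int[mu]_(s in `]t, y]) c = (y - t) * c.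
Proof.
move=> ty; rewrite Rintegral_cst//= lebesgue_measure_itv/= lte_fin mulrC.
case: ltP => [//|yt]; rewrite (_ : y = t) ?subrr//.
by apply/eqP; rewrite eq_le yt ty.
Qed.

Lemma primitive_ge (t y : R) : 0 <= t <= y -> (y - t) * eps y <= N y - N t.
Proof.
move=> /[dup] tyb /andP[t0 ty]; rewrite primitiveB// -cst_oc//.
apply: le_Rintegral => //; [exact: int_cst|exact: int_oc|].
move=> s /=; rewrite in_itv/= => /andP[ts sy].
by apply: eps_decr => //; rewrite ltW// (le_lt_trans t0).
Qed.

Lemma primitive_le (t y : R) : 0 <= t <= y -> N y - N t <= (y - t) * eps t.
Proof.
move=> /[dup] tyb /andP[t0 ty]; rewrite primitiveB// -cst_oc//.
apply: le_Rintegral => //; [exact: int_oc|exact: int_cst|].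
move=> s /=; rewrite in_itv/= => /andP[ts sy].
by apply: eps_decr => //; rewrite ltW.
Qed.

Lemma primitive_le_total (t : R) : N t <= \int[mu]_(s in `[0, +oo[) eps s.
Proof.
apply: ge0_subset_Rintegral => //.
- by move=> s /=; rewrite !in_itv/= andbT => /andP[].
- by move=> s /=; rewrite in_itv/= andbT => s0; exact: eps_ge0.
Qed.

Lemma primitiveB_le_tail (t y : R) : 0 <= t <= y ->
  4 * (N y - N t) <= \int[mu]_(s in `[t, +oo[) (4 * eps s).
Proof.
move=> /[dup] tyb /andP[t0 ty].
have itl : mu.-integrable `[t, +oo[ (EFin \o eps).
  apply: integrableS eps_int => //.
  by apply: subset_itvr; rewrite bnd_simp.
rewrite RintegralZl// ler_wpM2l// primitiveB//.
apply: ge0_subset_Rintegral => //.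
- by move=> s /=; rewrite !in_itv/= andbT => /andP[/ltW].
- by move=> s /=; rewrite in_itv/= andbT => ts; apply: eps_ge0; exact: le_trans ts.
Qed.

End primitive.
End half_line_integrals.

(** * The derivative of the solution *)

Section derivative_bound.
Context (R : realType) (X : completeNormedModType R).
Notation mu := (@lebesgue_measure R).
Variables (T : X -> X) (f : R -> X) (x0 : X) (u : R -> X) (eps : R -> R).
Hypothesis T_nonexp : nonexpansive T.
Hypothesis u_sol : is_solution T f x0 u.
Hypothesis eps_ge0 : forall t : R, 0 <= t -> 0 <= eps t.
Hypothesis eps_cont : {within `[0, +oo[, continuous eps}.
Hypothesis eps_f : forall t : R, 0 <= t -> `|f t| <= eps t.
Hypothesis eps_decr : forall s t : R, 0 <= s -> s <= t -> eps t <= eps s.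
Hypothesis eps_fin :
  (\int[mu]_(t in `[0%R, +oo[) (eps t)%:E < +oo)%E.

Lemma measurable_eps : measurable_fun (`[0, +oo[%classic : set R) eps.
Proof. exact: subspace_continuous_measurable_fun. Qed.

Lemma integrable_eps : mu.-integrable `[0%R, +oo[ (EFin \o eps).
Proof. apply: ge0_integrable_half_line => //; exact: measurable_eps. Qed.

Lemma eps_right (t : R) : 0 <= t -> eps y @[y --> t^'+] --> eps t.
Proof.
have [c0 r0] := (continuous_within_itvcyP _ _).1 eps_cont.
rewrite le_eqVlt => /predU1P[<-//|t0].
by apply: cvg_at_right_filter; apply: c0; rewrite in_itv/= t0.
Qed.

Let S := \int[mu]_(t in `[0, +oo[) eps t.

(** The bound with a single fixed point; [dist] is obtained by taking the
    infimum over fixed points. *)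
Lemma derivative_bound_at (p : X) (t : R) : Fix T p -> 1 <= t ->
  `|derive1 u t| <= (2 * `|x0 - p| + 2 * Num.sqrt 2 * S) / Num.sqrt pi / Num.sqrt t
     + \int[mu]_(s in `[t / 2, +oo[) (4 * eps s).
Proof.
move=> Tp t1.
have t0 : 0 < t by lra.
pose N (t : R) := \int[mu]_(s in `[0, t]) eps s.
have Nge := primitive_ge eps_decr integrable_eps.
have Nle := primitive_le eps_decr integrable_eps.
set h := t / 2.
have h0 : 0 < h by rewrite divr_gt0.
have ht : h <= t by rewrite /h; lra.
have hti : 0 <= h <= t by rewrite (ltW h0) ht.
have tail := primitiveB_le_tail eps_ge0 integrable_eps hti.
have NhS : N h <= S := primitive_le_total eps_ge0 integrable_eps h.
(* [eps t <= (2 / t) * int_(t/2)^t eps], and [2 / t <= 2]. *)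
have epst : eps t <= 2 * (N t - N h).
  have H1 := Nge h t hti.
  have H2 : 0 <= eps t by apply: eps_ge0; lra.
  have H3 : t - h = h by rewrite /h; lra.
  have H4 : 1 <= 2 * h by rewrite /h; lra.
  have H5 := ler_wpM2r H2 H4.
  move: H1; rewrite H3 -/(N t) -/(N h); lra.
have dub : `|derive1 u t| <= `|u t - T (u t)| + eps t.
  case: u_sol => _ _ /(_ t t0)[_ dutE].
  have -> : derive1 u t = f t - (u t - T (u t)) by rewrite -dutE addrK.
  by rewrite (le_trans (ler_normB _ _))// addrC lerD2l eps_f// ltW.
have r0 : 0 <= `|x0 - p| by [].
have Nh0 : 0 <= N h.
  have hh : (0 : R) <= 0 <= h by rewrite lexx ltW.
  have := Nge _ _ hh; rewrite primitive_at0 !subr0 => /(le_trans _); apply.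
  by rewrite mulr_ge0 ?(ltW h0)// eps_ge0// ltW.
set r := `|x0 - p| in r0 *.
have pi0 : 0 < pi :> R by exact: pi_gt0.
have sp0 : 0 < Num.sqrt pi :> R by rewrite sqrtr_gt0.
have st0 : 0 < Num.sqrt t by rewrite sqrtr_gt0.
(* The error [delta] of the profile is removed by letting it tend to [0]. *)
have main : `|u t - T (u t)| <= 2 * r * (Num.sqrt (pi * t))^-1 +
    2 * N h * (Num.sqrt (pi * h))^-1 + 2 * (N t - N h).
  apply/ler_addgt0Pr => e e0.
  have K0 : 0 < 2 * r + 2 * N h + 1 by lra.
  pose delta := e / (2 * r + 2 * N h + 1).
  have delta0 : 0 < delta by rewrite divr_gt0.
  have [M [M_tail M_diag]] := profile_exists (ltW t0) delta0.
  have := residual_bound T_nonexp u_sol eps_f (primitive_at0 _) eps_ge0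
    eps_decr eps_right Nge Nle Tp (ltW t0) M_tail h0 ht.
  move=> /le_trans; apply.
  have -> : t - h = h by rewrite /h; lra.
  have M1 : profE M t t <= (Num.sqrt (pi * t))^-1 + delta.
    by apply: M_diag; rewrite t0 lexx.
  have M2 : profE M h h <= (Num.sqrt (pi * h))^-1 + delta.
    by apply: M_diag; rewrite h0.
  have M1' := ler_wpM2l (mulr_ge0 (ler0n R 2) r0) M1.
  have M2' := ler_wpM2l (mulr_ge0 (ler0n R 2) Nh0) M2.
  have de : delta * (2 * r + 2 * N h) <= e.
    rewrite /delta mulrAC ler_pdivrMr// ler_pM2l//; lra.
  move: M1' M2' de; rewrite -/(N h) -/(N t) -/r; lra.
have sh : (Num.sqrt (pi * h))^-1 = Num.sqrt 2 * (Num.sqrt (pi * t))^-1.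
  have s20 : 0 < Num.sqrt 2 :> R by rewrite sqrtr_gt0.
  have -> : t = h * 2 by rewrite /h divfK.
  have ph0 : 0 <= pi * h by rewrite ltW// mulr_gt0.
  rewrite mulrA [in RHS](sqrtrM _ ph0).
  by rewrite invfM [RHS]mulrC mulfVK ?gt_eqF.
have sqrt2_ge0 : 0 <= Num.sqrt 2 :> R by exact: sqrtr_ge0.
move: main; rewrite sh sqrtrM ?(ltW pi0)// invfM.
set A := _ / Num.sqrt t => main.
have A0 : 0 <= A by rewrite mulr_ge0 ?invr_ge0 ?ltW.
rewrite -(mulrA _ _ (Num.sqrt t)^-1) -/A.
have SA : N h * (Num.sqrt 2 * A) <= S * (Num.sqrt 2 * A).
  by rewrite ler_wpM2r// mulr_ge0.
move: tail; rewrite -/(N h) -/(N t) => tail.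
lra.
Qed.

Lemma derivative_bound (t : R) : Fix T !=set0 -> 1 <= t ->
  `|derive1 u t| <=
     (2 * dist x0 (Fix T) + S + 2 * Num.sqrt 2 * S) / Num.sqrt pi / Num.sqrt t
     + \int[mu]_(s in `[t / 2, +oo[) (4 * eps s).
Proof.
move=> FixT t1.
set W := \int[mu]_(s in _) _.
have t0 : 0 < t by lra.
have K0 : 0 < (Num.sqrt pi)^-1 / Num.sqrt t :> R.
  by rewrite divr_gt0 ?invr_gt0 ?sqrtr_gt0 ?pi_gt0.
rewrite -(mulrA _ _ (Num.sqrt t)^-1).
set K := _ / Num.sqrt t in K0 *.
have S0 : 0 <= S.
  by apply: Rintegral_ge0 => s /=; rewrite in_itv/= andbT; exact: eps_ge0.
have low : (`|derive1 u t| - W) / K / 2 - Num.sqrt 2 * S <= dist x0 (Fix T).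
  apply: lb_le_inf; first by case: FixT => p Tp; exists `|x0 - p|; exists p.
  move=> _ [p Tp <-].
  have := derivative_bound_at Tp t1; rewrite -/W -(mulrA _ _ (Num.sqrt t)^-1) -/K.
  rewrite -lerBlDr -ler_pdivrMr// => ?; lra.
rewrite -lerBlDr -ler_pdivrMr//; lra.
Qed.

End derivative_bound.

Unset Implicit Arguments.

Theorem theorem5p3 (R : realType) (X : completeNormedModType R)
    (T : X -> X) (f : R -> X) (x0 : X) (u : R -> X) (eps : R -> R)
    (T_nonexp : nonexpansive T)
    (f_cont : {within `[0, +oo[, continuous f})
    (u_sol : is_solution T f x0 u)
    (eps_ge0 : forall t : R, 0 <= t -> 0 <= eps t)
    (eps_cont : {within `[0, +oo[, continuous eps})
    (eps_f : forall t : R, 0 <= t -> `|f t| <= eps t)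
    (FixT : Fix T !=set0)
    (eps_decr : forall s t : R, 0 <= s -> s <= t -> eps t <= eps s)
    (eps_fin : (\int[lebesgue_measure]_(t in `[0%R, +oo[) (eps t)%:E < +oo)%E) :
  let S := \int[lebesgue_measure]_(t in `[0, +oo[) eps t in
  let kappa := 2 * dist x0 (Fix T) + S in
  let nu := (kappa + 2 * Num.sqrt 2 * S) / Num.sqrt pi in
  [/\ (forall t : R, 1 <= t ->
         `|derive1 u t| <= nu / Num.sqrt t
           + \int[lebesgue_measure]_(s in `[t / 2, +oo[) (4 * eps s)),
      (forall phi : R -> R,
         (forall s : R, 0 <= s -> 0 <= phi s) ->
         (forall s t : R, 0 <= s -> s <= t -> phi s <= phi t) ->
         (\int[lebesgue_measure]_(s in `[0%R, +oo[) (phi s * eps s)%:E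
            < +oo)%E ->
         let mu := \int[lebesgue_measure]_(s in `[0, +oo[) (phi s * eps s) in
         forall t : R, 1 <= t -> 0 < phi (t / 2) ->
           `|derive1 u t| <= nu / Num.sqrt t + 4 * mu / phi (t / 2))
    & (forall a : R, 0 <= a ->
         (\int[lebesgue_measure]_(s in `[0%R, +oo[) (s `^ a * eps s)%:E
            < +oo)%E ->
         let b := Num.min (1 / 2) a in
         exists2 C : R, 0 < C &
           \forall t \near +oo_R, `|derive1 u t| <= C * `|1 / t `^ b|)].
Proof.
move=> S kappa nu.
have part1 (t : R) : 1 <= t -> `|derive1 u t| <= nu / Num.sqrt t
    + \int[lebesgue_measure]_(s in `[t / 2, +oo[) (4 * eps s).
  exact: (derivative_bound T_nonexp u_sol eps_ge0 eps_cont eps_f eps_decr eps_fin).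
have part2 (phi : R -> R) :
    (forall s : R, 0 <= s -> 0 <= phi s) ->
    (forall s t : R, 0 <= s -> s <= t -> phi s <= phi t) ->
    (\int[lebesgue_measure]_(s in `[0%R, +oo[) (phi s * eps s)%:E < +oo)%E ->
    let mu := \int[lebesgue_measure]_(s in `[0, +oo[) (phi s * eps s) in
    forall t : R, 1 <= t -> 0 < phi (t / 2) ->
      `|derive1 u t| <= nu / Num.sqrt t + 4 * mu / phi (t / 2).
  move=> phi0 phi_nd fin mu t t1 phit.
  apply: (le_trans (part1 t t1)); rewrite lerD2l.
  have h0 : 0 <= t / 2 by rewrite divr_ge0// (le_trans _ t1).
  have ie := integrable_eps eps_ge0 eps_cont eps_fin.
  rewrite RintegralZl//; last first.
    apply: integrableS ie => //.
    by apply: subset_itvr; rewrite bnd_simp.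
  rewrite -(mulrA 4) ler_wpM2l// ler_pdivlMr// mulrC.
  exact: (weighted_tail_le (measurable_eps eps_cont)).
split => //.
move=> a a0 fin b.
have phi0 (s : R) : 0 <= s -> 0 <= s `^ a by move=> _; exact: powR_ge0.
have phi_nd (s t : R) : 0 <= s -> s <= t -> s `^ a <= t `^ a.
  by move=> s0 st; apply: ge0_ler_powR; rewrite ?nnegrE// (le_trans s0).
have bound := part2 _ phi0 phi_nd fin.
set mu := \int[_]_(s in _) _ in bound.
have mu0 : 0 <= mu.
  apply: Rintegral_ge0 => s /=; rewrite in_itv/= andbT => s0.
  by rewrite mulr_ge0 ?powR_ge0 ?eps_ge0.
exists (`|nu| + 4 * mu * 2 `^ a + 1).
  by rewrite ltr_wpDl// addr_ge0// !mulr_ge0// powR_ge0.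
near=> t.
have t1 : 1 <= t by near: t; exact: nbhs_pinfty_ge.
have t0 : 0 < t by rewrite (lt_le_trans _ t1).
have tb0 : 0 < t `^ b by exact: powR_gt0.
have ta0 : 0 < t `^ a by exact: powR_gt0.
have st0 : 0 < Num.sqrt t by rewrite sqrtr_gt0.
have t20 : 0 < t / 2 by rewrite divr_gt0.
apply: (le_trans (bound t t1 (powR_gt0 _ t20))).
have hb : 0 <= 1 / t `^ b by rewrite divr_ge0 ?(ltW tb0).
rewrite (ger0_norm hb).
(* For [t >= 1] both rates are dominated by [t `^ (- b)]. *)
have le1 : (Num.sqrt t)^-1 <= 1 / t `^ b.
  rewrite div1r lef_pV2 ?posrE// -powR12_sqrt ?(ltW t0)//.
  by apply: ler_powR => //; rewrite -div1r ge_min lexx.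
have le2 : (t `^ a)^-1 <= 1 / t `^ b.
  rewrite div1r lef_pV2 ?posrE//.
  by apply: ler_powR => //; rewrite ge_min lexx orbT.
have split_pow : t `^ a = (t / 2) `^ a * 2 `^ a.
  by rewrite -powRM ?(ltW t20)// divfK.
have h1 : nu / Num.sqrt t <= `|nu| * (1 / t `^ b).
  apply: (@le_trans _ _ (`|nu| / Num.sqrt t)).
    by rewrite ler_wpM2r ?invr_ge0 ?(ltW st0)// ler_norm.
  by rewrite ler_wpM2l.
have h2 : 4 * mu / (t / 2) `^ a <= 4 * mu * 2 `^ a * (1 / t `^ b).
  have -> : 4 * mu / (t / 2) `^ a = 4 * mu * 2 `^ a * (t `^ a)^-1.
    by rewrite split_pow; field; rewrite !gt_eqF// powR_gt0.
  by rewrite ler_wpM2l// !mulr_ge0// powR_ge0.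
apply: (le_trans (lerD h1 h2)).
by rewrite -mulrDl ler_wpM2r ?divr_ge0 ?(ltW tb0)// lerDl.
Unshelve. all: by end_near. Qed.
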